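(* Let $n\ge 1$, $\beta>0$ and $U\in C^\infty(\mathbb{R}^n,\mathbb{R})$. For $G\in C^2(\mathbb{R}^n,\mathbb{R})$ let $LG(x)=-\nabla U(x)\cdot\nabla G(x)+\beta^{-1}\operatorname{trace}[D^2G(x)]$. Assume: (i) there is $K_1>0$ with $U(x)\ge K_1|x|$ for all $x\in\mathbb{R}^n$; (ii) for every integer $\ell\ge1$ there are $\delta_\ell>0$ and $M_\ell>0$ with $L\{U^\ell\}(x)\le-\delta_\ell U(x)^\ell+M_\ell$ for all $x\in\mathbb{R}^n$; (iii) there is $K_2>0$ with $|\nabla U(x)-\nabla U(y)|\le K_2(U(x)+U(y))|x-y|$ for all $x,y\in\mathbb{R}^n$; (iv) there is $K_3>0$ with $\langle-\nabla U(x)+\nabla U(y),x-y\rangle\le K_3|x-y|^2$ for all $x,y\in\mathbb{R}^n$; (v) there is $K_4>0$ with $\max(\|D^3U(x)\|,\|D^2U(x)\|,|\nabla U(x)|)\le K_4(1+U(x))$ for all $x\in\mathbb{R}^n$. Let $h>0$ and let $P_h^k$ be the $k$-step transition probability of MALA with time step $h$, and $\mu$ the probability measure with density proportional to $e^{-\beta U}$. Then $$\sup_{A\in\mathcal{B}(\mathbb{R}^n)}|P_h^k(x,A)-\mu(A)|\to0\quad\text{as }k\to\infty,\qquad\text{for all }x\in\mathbb{R}^n.$$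
   Context: $|\cdot|$ is the Euclidean norm, $\|\cdot\|$ the Frobenius norm, $a\wedge b=\min(a,b)$, $\mathcal{B}(\mathbb{R}^n)$ the Borel $\sigma$-algebra. $\mu(dx)=\pi(x)\,dx$ with $\pi(x)=Z^{-1}\exp(-\beta U(x))$, $Z=\int_{\mathbb{R}^n}\exp(-\beta U)\,dx$. Let $$q_h(x,y)=(4\pi\beta^{-1}h)^{-n/2}\exp\left(-\frac{|y-x+h\nabla U(x)|^2}{4\beta^{-1}h}\right)$$ (here, in the prefactor, $\pi$ is the number), $\alpha_h(x,y)=1\wedge\frac{q_h(y,x)\pi(y)}{q_h(x,y)\pi(x)}$ (here $\pi$ is the density), $p_h(x,y)=q_h(x,y)\alpha_h(x,y)$ and $r_h(x)=1-\int_{\mathbb{R}^n}p_h(x,z)\,dz$. The MALA (Metropolis-adjusted Langevin algorithm) transition kernel is $P_h(x,dy)=p_h(x,y)\,dy+r_h(x)\delta_x(dy)$, and $P_h^k(x,A)=\int_{\mathbb{R}^n}P_h(x,dy)P_h^{k-1}(y,A)$ for $k\ge1$, with $P_h^0(x,A)=\chi_A(x)$ the indicator function of $A$. *)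

(* Defs.v *)
From HB Require Import structures.
From mathcomp Require Import all_boot all_order all_algebra.
From mathcomp Require Import lra.
From mathcomp Require Import all_classical all_reals all_analysis.
From mathcomp Require Import measurable_realfun.

Set Implicit Arguments.
Unset Strict Implicit.
Unset Printing Implicit Defensive.

Import Order.TTheory GRing.Theory Num.Theory.
Import numFieldNormedType.Exports.

Local Open Scope classical_set_scope.
Local Open Scope ring_scope.

(* Matrices, in particular the row vectors 'rV[R]_n standing for R^n, carry
   the Borel sigma-algebra of their topology. *)
Section borel_matrix.
Variables (R : realType) (m n : nat).

HB.instance Definition _ :=
  @isMeasurable.Build (sigma_display (@open 'M[R]_(m, n))) 'M[R]_(m, n)
    <<s @open 'M[R]_(m, n) >>
    (@sigma_algebra0 _ setT _) (@sigma_algebraC _ _)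
    (@sigma_algebra_bigcup _ setT _).

Lemma measurable_mxE : @measurable _ 'M[R]_(m, n) = <<s @open 'M[R]_(m, n) >>.
Proof. by []. Qed.

Lemma open_measurable_mx (A : set 'M[R]_(m, n)) : open A -> measurable A.
Proof. exact: sub_sigma_algebra. Qed.

Lemma measurable_coord (i : 'I_m) (j : 'I_n) :
  measurable_fun [set: 'M[R]_(m, n)] (fun x => x i j).
Proof.
apply: (measurability _ (RGenOpens.measurableE R)) => _ [_ [a [b ->]] <-].
rewrite setTI; apply: open_measurable_mx.
by apply: open_comp; [move=> x _; exact: coord_continuous|exact: interval_open].
Qed.

End borel_matrix.

Lemma open_bigcup_rat_ball (R : realType) n (A : set 'rV[R]_n) : open A ->
  A = \bigcup_(q in [set q : 'rV[rat]_n * rat |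
                       ball (map_mx ratr q.1 : 'rV[R]_n) (ratr q.2) `<=` A])
        ball (map_mx ratr q.1 : 'rV[R]_n) (ratr q.2).
Proof.
move=> oA; apply/seteqP; split => [x Ax|x [q /= qA]]; last exact: qA.
have /nbhs_ballP[e /= e0 eA] : nbhs x A by exact: open_nbhs_nbhs.
have [r] : exists r : rat, ratr r \in `]0, (e / 2)[.
  by apply: rat_in_itvoo; rewrite divr_gt0.
rewrite in_itv /= => /andP[r0 re].
have /choice[q qP] : forall i, exists q : rat,
    ratr q \in `](x 0 i - ratr r), (x 0 i + ratr r)[.
  by move=> i; apply: rat_in_itvoo; rewrite ltrD2l gtrN.
have xq : ball (map_mx ratr (\row_i q i) : 'rV[R]_n) (ratr r) x.
  split => // i j; rewrite !mxE ord1 /ball /= ltr_distl.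
  by move: (qP j); rewrite in_itv/= => /andP[? ?]; rewrite ltrBlDr -ltrBlDr; lra.
exists (\row_i q i, r) => //= y qy; apply: eA.
apply: (@le_ball _ _ _ (ratr r + ratr r)); first by lra.
exact: ball_triangle (ball_sym xq) qy.
Qed.

Lemma measurable_fun_rV (R : realType) d (T : measurableType d) n
    (f : T -> 'rV[R]_n) :
  (forall i, measurable_fun [set: T] (fun t => f t 0 i)) ->
  measurable_fun [set: T] f.
Proof.
move=> mf; apply: (measurability _ (@measurable_mxE R 1 n)) => _ [A oA <-].
rewrite setTI (open_bigcup_rat_ball oA) preimage_bigcup bigcup_mkcond.
apply: countable_bigcupT_measurable => // q; case: ifPn => // _.
have [q0|q0] := ltP 0 (ratr q.2 : R); last first.
  rewrite (_ : _ @^-1` _ = set0) //; apply/seteqP; split => // t [].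
  by rewrite ltNge q0.
rewrite (_ : _ @^-1` _ = \bigcap_(i in [set: 'I_n])
    (fun t => f t 0 i) @^-1` (ball (ratr (q.1 0 i) : R) (ratr q.2))).
  apply: fin_bigcap_measurable => // i _; rewrite -[X in measurable X]setTI.
  by apply: mf => //; apply: open_measurable; exact: ball_open.
apply/seteqP; split => [t [_ H] i _|t H]; first by have := H 0 i; rewrite mxE.
by split => // i j; rewrite ord1 mxE; exact: H.
Qed.

Section lebesgue_rV_step.
Local Open Scope ereal_scope.
Variables (R : realType) (n : nat).

Definition cons_rV (p : R * 'rV[R]_n) : 'rV[R]_n.+1 := row_mx p.1%:M p.2.

Lemma cons_rV0 p : cons_rV p 0%R ord0 = p.1.
Proof.
transitivity (row_mx p.1%:M p.2 0%R (lshift n (ord0 : 'I_1))).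
  by congr (fun_of_matrix _ _ _); exact/val_inj.
by rewrite row_mxEl mxE.
Qed.

Lemma cons_rVS p i : cons_rV p 0%R (lift ord0 i) = p.2 0%R i.
Proof.
transitivity (row_mx p.1%:M p.2 0%R (rshift 1 i)).
  by congr (fun_of_matrix _ _ _); exact/val_inj.
by rewrite row_mxEr.
Qed.

Lemma measurable_cons_rV : measurable_fun setT cons_rV.
Proof.
apply: measurable_fun_rV => i; case: (unliftP ord0 i) => [j|] ->.
  rewrite (_ : (fun t => _) = (fun x : 'rV[R]_n => x 0%R j) \o snd).
    by apply: measurableT_comp => //; exact: measurable_coord.
  by apply/funext => t; exact: cons_rVS.
rewrite (_ : (fun t => _) = fst)//; last by apply/funext => t; exact: cons_rV0.
Qed.

Variable mu : {sigma_finite_measure set 'rV[R]_n -> \bar R}.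

Definition lebesgue_step : set 'rV[R]_n.+1 -> \bar R :=
  pushforward (lebesgue_measure \x mu) cons_rV.

HB.instance Definition _ := Measure.copy lebesgue_step
  (measure_function_pushforward__canonical__measure_function_Measure
     (lebesgue_measure \x mu) measurable_cons_rV).

Let sigma_finite_step : sigma_finite setT lebesgue_step.
Proof.
have /sigma_finiteP[F [UF ndF mF]] := sigma_finiteT (@lebesgue_measure R).
have /sigma_finiteP[G [UG ndG mG]] := sigma_finiteT mu.
pose tl_rV (x : 'rV[R]_n.+1) : R * 'rV[R]_n :=
  (x 0%R ord0, \row_j x 0%R (lift ord0 j)).
have cons_tl x : cons_rV (tl_rV x) = x.
  apply/rowP => i; case: (unliftP ord0 i) => [j|] ->.
    by rewrite cons_rVS mxE.
  by rewrite cons_rV0.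
have tl_cons p : tl_rV (cons_rV p) = p.
  rewrite /tl_rV cons_rV0 [RHS]surjective_pairing; congr pair.
  by apply/rowP => j; rewrite mxE cons_rVS.
have mtl : measurable_fun setT tl_rV.
  apply/measurable_fun_pair => /=; first exact: measurable_coord.
  apply: measurable_fun_rV => j.
  rewrite (_ : (fun t => _) = fun x : 'rV[R]_n.+1 => x 0%R (lift ord0 j)).
    exact: measurable_coord.
  by apply/funext => t; rewrite mxE.
exists (fun k => tl_rV @^-1` (F k `*` G k)).
  rewrite -preimage_bigcup [X in _ @^-1` X](_ : _ = setT) ?preimage_setT//.
  rewrite -setXTT UF UG; apply/seteqP; split => -[x y].
    by move=> [k _ [? ?]]; split; exists k.
  move=> [[i _ Fix] [j _ Gjy]]; exists (maxn i j) => //; split => /=.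
    by have /subsetPset := ndF _ _ (leq_maxl i j); exact.
  by have /subsetPset := ndG _ _ (leq_maxr i j); exact.
move=> k; have [mFk Fkoo] := mF k; have [mGk Gkoo] := mG k.
have mFG : measurable (F k `*` G k) by exact: measurableX.
split; first by rewrite -[X in measurable X]setTI; exact: mtl.
rewrite /lebesgue_step /pushforward -comp_preimage (_ : _ \o _ = id); last first.
  by apply/funext => p /=; exact: tl_cons.
by rewrite preimage_id product_measure1E// lte_mul_pinfty// ge0_fin_numE.
Qed.

HB.instance Definition _ :=
  Measure_isSigmaFinite.Build _ _ _ lebesgue_step sigma_finite_step.

End lebesgue_rV_step.

Fixpoint lebesgue_rV (R : realType) (n : nat) :
    {sigma_finite_measure set 'rV[R]_n -> \bar R} :=
  if n is m.+1 then lebesgue_step (lebesgue_rV R m) else dirac (0%R : 'rV[R]_0).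

Lemma lebesgue_rV_setX (R : realType) n (B : 'I_n -> set R) :
  (forall i, measurable (B i)) ->
  lebesgue_rV R n [set x | forall i, B i (x 0 i)] =
    (\prod_(i < n) lebesgue_measure (B i))%E.
Proof.
elim: n B => [|n IHn] B mB.
  by rewrite big_ord0 /= diracE mem_set// => -[].
rewrite big_ord_recl -IHn; last by move=> i; exact: mB.
rewrite /= /lebesgue_step /pushforward -product_measure1E//.
  congr (_ _); apply/seteqP; split => [p /= Bp|p /= [Bp0 BpS] i].
    split; first by have := Bp ord0; rewrite cons_rV0.
    by move=> i; have := Bp (lift ord0 i); rewrite cons_rVS.
  by case: (unliftP ord0 i) => [j|] ->; rewrite (cons_rVS, cons_rV0).
  exact: mB.
rewrite (_ : (fun x : 'rV[R]_n => _) = \bigcap_(i in [set: 'I_n])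
    (fun x : 'rV[R]_n => x 0 i) @^-1` B (lift ord0 i)).
  apply: fin_bigcap_measurable => // i _; rewrite -[X in measurable X]setTI.
  by apply: measurable_coord.
by apply/seteqP; split => [x H i _|x H i]; exact: H.
Qed.



Section euclidean.
Variables (R : realType) (n : nat).
Implicit Types (u v x : 'rV[R]_n) (f : 'rV[R]_n -> R).

Definition dotp u v : R := \sum_(i < n) u 0 i * v 0 i.

(* The library norm `|u| on matrices is the sup norm. *)
Definition enorm u : R := Num.sqrt (dotp u u).

Definition partial (i : 'I_n) f : 'rV[R]_n -> R := 'D_(delta_mx 0 i) f.

Fixpoint Ck (k : nat) f : Prop :=
  if k is k'.+1 then
    (forall x, differentiable f x) /\ forall i, Ck k' (partial i f)
  else continuous f.

Definition smooth f : Prop := forall k, Ck k f.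

Definition gradient f x : 'rV[R]_n := \row_i partial i f x.

Definition hessian f x : 'M[R]_n := \matrix_(i, j) partial i (partial j f) x.

Definition normD2 f x : R :=
  Num.sqrt (\sum_(i < n) \sum_(j < n) hessian f x i j ^+ 2).

Definition normD3 f x : R :=
  Num.sqrt (\sum_(i < n) \sum_(j < n) \sum_(k < n)
    partial i (partial j (partial k f)) x ^+ 2).

End euclidean.

Section mala.
Variables (R : realType) (n : nat) (beta : R) (U : 'rV[R]_n -> R).
Implicit Types (x y : 'rV[R]_n) (A : set 'rV[R]_n).

Definition generator (G : 'rV[R]_n -> R) x : R :=
  - dotp (gradient U x) (gradient G x) + beta^-1 * \tr (hessian G x).

Definition partition_fun : R :=
  \int[lebesgue_rV R n]_x expR (- (beta * U x)).

Definition gibbs_density x : R := partition_fun^-1 * expR (- (beta * U x)).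

Definition gibbs A : \bar R :=
  (\int[lebesgue_rV R n]_(x in A) (gibbs_density x)%:E)%E.

Variable h : R.

Definition proposal x y : R :=
  (4 * pi * beta^-1 * h) `^ (- (n%:R / 2)) *
  expR (- (enorm (y - x + h *: gradient U x) ^+ 2 / (4 * beta^-1 * h))).

Definition acceptance x y : R :=
  Num.min 1 ((proposal y x * gibbs_density y) /
             (proposal x y * gibbs_density x)).

Definition accepted x y : R := proposal x y * acceptance x y.

Definition rejection x : \bar R :=
  (1 - \int[lebesgue_rV R n]_z (accepted x z)%:E)%E.

(* A bare set function: [rejection x] is a difference, so that this is a measure
   only once the accepted mass is known to be at most 1.  The integral of the
   library is defined against set functions and does not need that fact. *)
Definition mala_kernel x A : \bar R :=
  (\int[lebesgue_rV R n]_(y in A) (accepted x y)%:E + rejection x * \d_x A)%E.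

Fixpoint mala_iter (k : nat) x A : \bar R :=
  if k is k'.+1 then (\int[mala_kernel x]_y mala_iter k' y A)%E
  else (\1_A x)%:E.

End mala.

(* Main.v *)
Require Import Defs.
From HB Require Import structures.
From mathcomp Require Import all_boot all_order all_algebra.
From mathcomp Require Import ring lra.
From mathcomp Require Import all_classical all_reals all_analysis.
From mathcomp Require Import measurable_realfun.

Set Implicit Arguments.
Unset Strict Implicit.
Unset Printing Implicit Defensive.

Import Order.TTheory GRing.Theory Num.Theory.
Import numFieldNormedType.Exports.

Local Open Scope classical_set_scope.
Local Open Scope ring_scope.

(** Let [q] be the density of the Gaussian proposal and [pi] that of the target
    [mu].  Relative to [mu], the accepted moves from [x] have density
      [s x y = min (q x y / pi y) (q y x / pi x)],
    which is symmetric, everywhere positive and, for fixed [x], bounded in [y],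
    since [q] is bounded.  The kernel acts on functions by
      [T g x = \int s x y g y mu(dy) + (1 - \int s x y mu(dy)) * g x],
    a positive operator that fixes constants and is self-adjoint in [L^2(mu)]
    ([metropolis_adjoint]), and the k-step transition probability of [A] is
    [T^k \1_A].

    The heart of the proof is that [T^k f] tends to 0 in [L^1(mu)] for every bounded
    [f] of mean 0 ([L1_iter_metropolis_cvg0]).  The iterates keep the sup bound [M]
    of [f], so a set [C] of nearly full measure carries nearly all of their positive
    and of their negative part.  If [s >= eps] on [C x C], then the two parts,
    which have equal mass, are both spread over [C] and cancel there, whence
      [L1 (T f) <= L1 f - eps * mu C * (L1 f - 2 * M * mu (~` C))]
    ([L1_metropolis_le]): a contraction towards [2 * M * mu (~` C)], which is
    arbitrarily small.

    It remains to start from a point [x], whose Dirac mass has no density.  Conditioning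
    on the first step, a rejection reproduces the same error with the factor
    [1 - mass x < 1], while an acceptance leads to the bounded density [s x], to which
    the [L^1] convergence applies once self-adjointness has moved the iterates from
    [\1_A] to that density; the resulting bound does not depend on [A]
    ([metropolis_cvg]).

    For the Langevin proposal, the sets [C] are the sublevel sets of
    [\sum_i (`|x_i| + h * `|d_i U x|)], on which the Gaussian density has an explicit
    lower bound ([s_lb]).  The growth of [U] enters in the finiteness of the
    partition function ([integral_expU_lty]). *)

(** * Bounded measurable functions *)

Section bounded_measurable.
Context d (X : measurableType d) (R : realType).
Implicit Types f g : X -> R.

Definition bounded_mfun f := measurable_fun setT f /\ exists M : R, forall x, `|f x| <= M.

Lemma bmfun_cst r : bounded_mfun (cst r).
Proof. by split; [exact: measurable_cst|exists `|r|]. Qed.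

Lemma bmfun_indic (A : set X) : measurable A -> bounded_mfun (\1_A).
Proof.
move=> mA; split; first exact: measurable_indic.
by exists 1 => x; rewrite indicE; case: (x \in A); rewrite ?normr1 ?normr0.
Qed.

Lemma bmfunD f g : bounded_mfun f -> bounded_mfun g -> bounded_mfun (fun x => f x + g x).
Proof.
move=> [mf [M fM]] [mg [N gN]]; split; first exact: measurable_funD.
by exists (M + N) => x; rewrite (le_trans (ler_normD _ _))// lerD.
Qed.

Lemma bmfunM f g : bounded_mfun f -> bounded_mfun g -> bounded_mfun (fun x => f x * g x).
Proof.
move=> [mf [M fM]] [mg [N gN]]; split; first exact: measurable_funM.
by exists (M * N) => x; rewrite normrM ler_pM.
Qed.

Lemma bmfunN f : bounded_mfun f -> bounded_mfun (fun x => - f x).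
Proof.
move=> [mf [M fM]]; split; first exact: measurableT_comp.
by exists M => x; rewrite normrN.
Qed.

Lemma bmfunB f g : bounded_mfun f -> bounded_mfun g -> bounded_mfun (fun x => f x - g x).
Proof. by move=> bf bg; apply: bmfunD => //; exact: bmfunN. Qed.

Lemma bmfun_norm f : bounded_mfun f -> bounded_mfun (fun x => `|f x|).
Proof.
move=> [mf [M fM]]; split; first exact: measurableT_comp.
by exists M => x; rewrite normr_id.
Qed.

Lemma bmfun_bounded f : bounded_mfun f -> [bounded f x | x in setT].
Proof.
move=> [_ [M fM]]; exists M; split; first exact: num_real.
by move=> N MN x _; rewrite /= (le_trans (fM x))// ltW.
Qed.

Lemma bmfun_integrable (mu : probability X R) f :
  bounded_mfun f -> mu.-integrable setT (EFin \o f).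
Proof.
move=> bf; apply: measurable_bounded_integrable => //.
- by rewrite -ge0_fin_numE//; exact: fin_num_measure.
- by case: bf.
- exact: bmfun_bounded.
Qed.

End bounded_measurable.

(** The form in which contraction is used below: a quantity that satisfies
    [b_(j+1) <= (1 - k) * b_j + k * e] stays below [e + (1 - k) ^ j * b_0], and
    hence is eventually at most [2 * e]. *)
Lemma geometric_near (R : realType) (k e B : R) : 0 < k <= 1 -> 0 < e ->
  \forall j \near \oo, e + (1 - k) ^+ j * B <= 2 * e.
Proof.
move=> /andP[k0 k1] e0.
have : (fun j => (1 - k) ^+ j * B) @ \oo --> 0 * B.
  by apply: cvgMl; apply: cvg_expr; rewrite ger0_norm; lra.
rewrite mul0r => /cvgrPdist_le/(_ _ e0); apply: filterS => j.
by rewrite sub0r normrN => /(le_trans (ler_norm _)); lra.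
Qed.

(** * Metropolis operators *)

Section metropolis.
Context d (X : measurableType d) (R : realType) (mu : probability X R).
Variable s : X -> X -> R.
Hypothesis ms : measurable_fun setT (fun z : X * X => s z.1 z.2).
Hypothesis s_ge0 : forall x y, 0 <= s x y.
Hypothesis s_sym : forall x y, s x y = s y x.
Hypothesis s_le1 : forall x, (\int[mu]_y (s x y)%:E <= 1)%E.

Implicit Types f g : X -> R.

(** The accepted moves have density [s x] with respect to the target [mu]
    itself.  With respect to that reference measure, detailed balance is the
    symmetry of [s], and the remaining mass stays at [x]. *)
Definition accept f x := \int[mu]_y (s x y * f y).

Definition mass x := \int[mu]_y s x y.

Definition metropolis f x := accept f x + (1 - mass x) * f x.

Local Notation T := metropolis.

Let muT : (mu : {measure set X -> \bar R}) setT = 1%E.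
Proof. exact: probability_setT. Qed.

Let ms1 x : measurable_fun setT (s x).
Proof. exact: (measurableT_comp ms (pair1_measurable x)). Qed.

Let is1 x : mu.-integrable setT (EFin \o s x).
Proof.
apply/integrableP; split; first exact/measurable_EFinP.
under eq_integral do rewrite /= ger0_norm//.
exact: le_lt_trans (s_le1 x) (ltry _).
Qed.

Lemma accept_integrable f x :
  bounded_mfun f -> mu.-integrable setT (EFin \o (fun y => s x y * f y)).
Proof.
move=> bf; have := integrableMl measurableT (is1 x) bf.1 (bmfun_bounded bf).
by apply: eq_integrable.
Qed.

Lemma mass_bounds x : 0 <= mass x <= 1.
Proof.
rewrite Rintegral_ge0//= /mass /Rintegral -lee_fin fineK ?s_le1//.
exact: integrable_fin_num (is1 x).
Qed.

Lemma accept_cst c x : accept (cst c) x = mass x * c.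
Proof. by rewrite /accept /= RintegralZr. Qed.

Lemma acceptD f g x : bounded_mfun f -> bounded_mfun g ->
  accept (fun y => f y + g y) x = accept f x + accept g x.
Proof.
move=> bf bg; rewrite /accept -RintegralD//; try exact: accept_integrable.
by apply: eq_Rintegral => y _; rewrite mulrDr.
Qed.

Lemma acceptN f x : bounded_mfun f -> accept (fun y => - f y) x = - accept f x.
Proof.
move=> bf; rewrite /accept -mulN1r -RintegralZl//; last exact: accept_integrable.
by apply: eq_Rintegral => y _; rewrite mulrN mulN1r.
Qed.

Lemma metropolis_cst c : T (cst c) = cst c.
Proof. by apply/funext => x; rewrite /metropolis accept_cst /=; ring. Qed.

Lemma metropolisD f g : bounded_mfun f -> bounded_mfun g ->
  T (fun x => f x + g x) = fun x => T f x + T g x.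
Proof.
by move=> bf bg; apply/funext => x; rewrite /metropolis acceptD//; ring.
Qed.

Lemma metropolisN f : bounded_mfun f -> T (fun x => - f x) = fun x => - T f x.
Proof.
by move=> bf; apply/funext => x; rewrite /metropolis acceptN//; ring.
Qed.

Lemma metropolis_ge0 f : (forall x, 0 <= f x) -> forall x, 0 <= T f x.
Proof.
move=> f0 x; rewrite /metropolis addr_ge0//.
  by apply: Rintegral_ge0 => y _; rewrite mulr_ge0.
by rewrite mulr_ge0// subr_ge0; case/andP: (mass_bounds x).
Qed.

Lemma metropolis_le f g : bounded_mfun f -> bounded_mfun g -> (forall x, f x <= g x) ->
  forall x, T f x <= T g x.
Proof.
move=> bf bg fg x; rewrite -subr_ge0.
have -> : T g x - T f x = T (fun y => g y + (- f y)) x.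
  by rewrite metropolisD ?metropolisN//; exact: bmfunN.
by apply: metropolis_ge0 => y; rewrite subr_ge0.
Qed.

Lemma metropolis_bound f M : bounded_mfun f ->
  (forall x, `|f x| <= M) -> forall x, `|T f x| <= M.
Proof.
move=> bf fM x; rewrite ler_norml.
have -> : - M = T (cst (- M)) x by rewrite metropolis_cst.
have -> : M = T (cst M) x by rewrite metropolis_cst.
apply/andP; split; apply: metropolis_le => //; try exact: bmfun_cst.
  by move=> y; have := fM y; rewrite metropolis_cst ler_norml /= => /andP[].
by move=> y; have := fM y; rewrite ler_norml => /andP[].
Qed.

(** The sections [s x] are only integrable, not bounded uniformly in [x]; joint
    integrability, on which every use of Fubini rests, comes from
    [\int s x y mu(dy) <= 1]. *)
Let joint_integrable f g : bounded_mfun f -> bounded_mfun g ->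
  (mu \x mu)%E.-integrable setT
    (fun z : X * X => (f z.1 * (s z.1 z.2 * g z.2))%:E).
Proof.
move=> bf bg; have [mf [M fM]] := bf; have [mg [N gN]] := bg.
apply/integrable12ltyP.
  apply/measurable_EFinP; apply: measurable_funM; first exact: measurableT_comp.
  by apply: measurable_funM => //; exact: measurableT_comp.
rewrite (@le_lt_trans _ _ (\int[mu]_x (M * N)%:E)%E)//; last first.
  by rewrite integral_cst// muT mule1 ltry.
have N0 (x : X) : 0 <= N by rewrite (le_trans _ (gN x)).
have M0 (x : X) : 0 <= M by rewrite (le_trans _ (fM x)).
apply: ge0_le_integral => //=.
- move=> x _; exact: integral_ge0.
- apply: (measurable_fun_fubini_tonelli_F
    (fun z : X * X => `|(f z.1 * (s z.1 z.2 * g z.2))%:E|%E)) => //=.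
  apply/measurable_EFinP; apply: measurableT_comp => //.
  apply: measurable_funM; first exact: measurableT_comp.
  by apply: measurable_funM => //; exact: measurableT_comp.
- move=> x _; rewrite (@le_trans _ _ (\int[mu]_y ((M * N)%:E * (s x y)%:E))%E)//.
    apply: ge0_le_integral => //=.
    + apply/measurable_EFinP; apply: measurableT_comp => //.
      by apply: measurable_funM => //; exact: measurable_funM.
    + by apply/measurable_EFinP; exact: measurable_funM.
    + move=> y _; rewrite -EFinM lee_fin !normrM (ger0_norm (s_ge0 _ _)).
      rewrite mulrCA mulrC ler_wpM2r// ler_pM//.
  rewrite ge0_integralZl//=; last 3 first.
  + exact/measurable_EFinP.
  + by move=> y _; rewrite lee_fin.
  + by rewrite lee_fin mulr_ge0 ?(N0 x) ?(M0 x).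
  by rewrite -[leRHS]mule1 lee_wpmul2l// lee_fin mulr_ge0 ?(N0 x) ?(M0 x).
Qed.

Lemma EFin_accept f x : bounded_mfun f ->
  (accept f x)%:E = (\int[mu]_y (s x y * f y)%:E)%E.
Proof.
move=> bf; rewrite /accept /Rintegral fineK//.
exact: integrable_fin_num (accept_integrable _ bf).
Qed.

Lemma measurable_accept f : bounded_mfun f -> measurable_fun setT (accept f).
Proof.
move=> bf; apply/measurable_EFinP.
rewrite (_ : _ \o _ = fubini_F mu
    (fun z : X * X => (cst 1 z.1 * (s z.1 z.2 * f z.2))%:E)).
  by apply: measurable_fubini_F; exact: joint_integrable (bmfun_cst _ 1) bf.
apply/funext => x; rewrite /= EFin_accept// /fubini_F/=.
by apply: eq_integral => y _; rewrite mul1r.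
Qed.

Let mass_accept : mass = accept (cst 1).
Proof. by apply/funext => x; rewrite accept_cst mulr1. Qed.

Lemma bmfun_mass : bounded_mfun mass.
Proof.
split; first by rewrite mass_accept; apply: measurable_accept; exact: bmfun_cst.
by exists 1 => x; have /andP[? ?] := mass_bounds x; rewrite ger0_norm.
Qed.

(** The bound is read off the one on [metropolis f]. *)
Lemma bmfun_accept f : bounded_mfun f -> bounded_mfun (accept f).
Proof.
move=> bf; split; first exact: measurable_accept.
have [_ [M fM]] := bf; exists (M + M) => x.
have -> : accept f x = T f x - (1 - mass x) * f x by rewrite /metropolis addrK.
rewrite (le_trans (ler_normB _ _))// lerD//; first exact: metropolis_bound.
rewrite normrM -[leRHS]mul1r ler_pM//.
have /andP[? ?] := mass_bounds x; rewrite ger0_norm; lra.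
Qed.

Lemma bmfun_metropolis f : bounded_mfun f -> bounded_mfun (T f).
Proof.
move=> bf; apply: bmfunD; first exact: bmfun_accept.
by apply: bmfunM => //; apply: bmfunB; [exact: bmfun_cst|exact: bmfun_mass].
Qed.

Lemma accept_adjoint f g : bounded_mfun f -> bounded_mfun g ->
  \int[mu]_x (f x * accept g x) = \int[mu]_x (g x * accept f x).
Proof.
move=> bf bg; rewrite /Rintegral; congr fine.
transitivity (\int[mu]_x \int[mu]_y (f x * (s x y * g y))%:E)%E.
  apply: eq_integral => x _; rewrite EFinM EFin_accept//.
  by rewrite -integralZl//; exact: accept_integrable.
rewrite (Fubini (joint_integrable bf bg)).
apply: eq_integral => y _; rewrite EFinM EFin_accept//.
rewrite -integralZl//; last exact: accept_integrable.
by apply: eq_integral => x _; rewrite -EFinM (s_sym x y); congr EFin; ring.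
Qed.

Lemma metropolis_adjoint f g : bounded_mfun f -> bounded_mfun g ->
  \int[mu]_x (f x * T g x) = \int[mu]_x (g x * T f x).
Proof.
have H u v : bounded_mfun u -> bounded_mfun v -> \int[mu]_x (u x * T v x) =
    \int[mu]_x (u x * accept v x) + \int[mu]_x (u x * ((1 - mass x) * v x)).
  move=> bu bv; rewrite -RintegralD//; last 2 first.
  - by apply: bmfun_integrable; apply: bmfunM => //; exact: bmfun_accept.
  - apply: bmfun_integrable; apply: bmfunM => //; apply: bmfunM => //.
    by apply: bmfunB; [exact: bmfun_cst|exact: bmfun_mass].
  by apply: eq_Rintegral => x _; rewrite -mulrDr.
move=> bf bg; rewrite !H// accept_adjoint//; congr (_ + _).
by apply: eq_Rintegral => x _; ring.
Qed.

(** Invariance of [mu] is self-adjointness tested against the constant 1, which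
    the operator fixes. *)
Lemma Rintegral_metropolis f : bounded_mfun f -> \int[mu]_x T f x = \int[mu]_x f x.
Proof.
move=> bf; transitivity (\int[mu]_x (cst 1 x * T f x)).
  by apply: eq_Rintegral => x _; rewrite mul1r.
rewrite metropolis_adjoint//; last exact: bmfun_cst.
by apply: eq_Rintegral => x _; rewrite metropolis_cst /= mulr1.
Qed.

Lemma bmfun_iter k f : bounded_mfun f -> bounded_mfun (iter k T f).
Proof. by move=> bf; elim: k => //= k; exact: bmfun_metropolis. Qed.

Lemma iter_metropolis_bound k f M : bounded_mfun f -> (forall x, `|f x| <= M) ->
  forall x, `|iter k T f x| <= M.
Proof.
move=> bf fM; elim: k => //= k IHk; apply: metropolis_bound => //.
exact: bmfun_iter.
Qed.

Lemma iter_metropolis_adjoint k f g : bounded_mfun f -> bounded_mfun g ->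
  \int[mu]_x (f x * iter k T g x) = \int[mu]_x (g x * iter k T f x).
Proof.
elim: k f g => [|k IHk] f g bf bg /=.
  by apply: eq_Rintegral => x _; rewrite mulrC.
rewrite metropolis_adjoint//; last exact: bmfun_iter.
transitivity (\int[mu]_x (T f x * iter k T g x)).
  by apply: eq_Rintegral => x _; rewrite mulrC.
by rewrite IHk//; [rewrite -iterSr|exact: bmfun_metropolis].
Qed.

Lemma Rintegral_iter k f : bounded_mfun f -> \int[mu]_x iter k T f x = \int[mu]_x f x.
Proof.
move=> bf; elim: k => //= k <-; rewrite Rintegral_metropolis//.
exact: bmfun_iter.
Qed.

Definition L1 f := \int[mu]_x `|f x|.

Let Rintegral_indic A : measurable A -> \int[mu]_x \1_A x = fine (mu A).
Proof. by move=> mA; rewrite /Rintegral integral_indic// setIT. Qed.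

(** The overlap estimate.  As [f] has mean 0, its positive part
    [(`|f| + f) / 2] has integral [L1 f / 2]; being bounded by [M], it loses at
    most [M * mu (~` C)] outside [C].  What is left in [C] is spread by the
    operator over all of [C] with density at least [eps]. *)
Let metropolis_minorization f M (C : set X) eps : bounded_mfun f ->
    (forall x, `|f x| <= M) -> \int[mu]_x f x = 0 -> measurable C -> 0 <= eps ->
    (forall x y, C x -> C y -> eps <= s x y) ->
  forall x, eps * (L1 f - 2 * M * fine (mu (~` C))) * \1_C x <=
    T (fun y => `|f y|) x + T f x.
Proof.
move=> bf fM f0 mC eps0 sC x.
have bu : bounded_mfun (fun y => `|f y| + f y) by apply: bmfunD => //; exact: bmfun_norm.
have u0 y : 0 <= `|f y| + f y by rewrite -lerBlDr sub0r -normrN ler_norm.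
have -> : T (fun y => `|f y|) x + T f x = T (fun y => `|f y| + f y) x.
  by rewrite metropolisD//; exact: bmfun_norm.
rewrite indicE; have [/[!inE] Cx|Cx] := boolP (x \in C); last first.
  by rewrite mulr0; exact: metropolis_ge0.
rewrite mulr1 /metropolis.
rewrite -[leLHS]addr0 lerD//; last first.
  by rewrite mulr_ge0// subr_ge0; case/andP: (mass_bounds x).
have mCc : measurable (~` C) by exact: measurableC.
have bv : bounded_mfun (fun y => (`|f y| + f y) - 2 * M * \1_(~` C) y).
  apply: bmfunB => //.
  by apply: (@bmfunM _ _ _ (cst (2 * M))); [exact: bmfun_cst|exact: bmfun_indic].
have -> : eps * (L1 f - 2 * M * fine (mu (~` C))) =
    \int[mu]_y (eps * ((`|f y| + f y) - 2 * M * \1_(~` C) y)).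
  rewrite RintegralZl//; last exact: bmfun_integrable.
  rewrite RintegralB//; last 2 first.
  - exact: bmfun_integrable.
  - apply: bmfun_integrable.
    by apply: (@bmfunM _ _ _ (cst (2 * M))); [exact: bmfun_cst|exact: bmfun_indic].
  rewrite RintegralD//; [|by apply: bmfun_integrable; exact: bmfun_norm
    |exact: bmfun_integrable].
  rewrite f0 addr0 RintegralZl//; last by apply: bmfun_integrable; exact: bmfun_indic.
  by rewrite Rintegral_indic.
apply: le_Rintegral => //.
- by apply: bmfun_integrable; apply: (@bmfunM _ _ _ (cst eps)) => //; exact: bmfun_cst.
- exact: accept_integrable.
move=> y _; rewrite indicE in_setC; have [/[!inE] Cy|Cy] /= := boolP (y \in C).
  by rewrite mulr0 subr0 ler_wpM2r// sC.
rewrite (@le_trans _ _ 0)//; last by rewrite mulr_ge0.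
rewrite mulr1 mulr_ge0_le0// subr_le0 mulr_natl mulr2n lerD//.
by rewrite (le_trans (ler_norm _)).
Qed.

(** Positive and negative parts of [f] are both spread over [C], so they cancel
    there: [`|T f| <= T `|f| - D] on [C], by the overlap estimate for [f] and for
    [- f]. *)
Lemma L1_metropolis_le f M (C : set X) eps : bounded_mfun f ->
    (forall x, `|f x| <= M) -> \int[mu]_x f x = 0 -> measurable C -> 0 <= eps ->
    (forall x y, C x -> C y -> eps <= s x y) ->
  L1 (T f) <=
    L1 f - eps * fine (mu C) * (L1 f - 2 * M * fine (mu (~` C))).
Proof.
move=> bf fM f0 mC eps0 sC.
set D := eps * (L1 f - 2 * M * fine (mu (~` C))).
have bn := bmfun_norm bf.
have bD : bounded_mfun (fun x => D * \1_C x).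
  by apply: (@bmfunM _ _ _ (cst D)); [exact: bmfun_cst|exact: bmfun_indic].
rewrite (@le_trans _ _ (\int[mu]_x (T (fun y => `|f y|) x - D * \1_C x)))//.
  apply: le_Rintegral => //.
  - by apply: bmfun_integrable; apply: bmfun_norm; exact: bmfun_metropolis.
  - by apply: bmfun_integrable; apply: bmfunB => //; exact: bmfun_metropolis.
  move=> x _.
  have H1 : D * \1_C x <= T (fun y => `|f y|) x + T f x.
    exact: metropolis_minorization.
  have H2 : D * \1_C x <= T (fun y => `|f y|) x - T f x.
    have EN : (fun y => `|f y|) = (fun y => `|- f y|).
      by apply/funext => y; rewrite normrN.
    have -> : - T f x = T (fun y => - f y) x by rewrite metropolisN.
    have -> : D = eps * (L1 (fun y => - f y) - 2 * M * fine (mu (~` C))).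
      by rewrite /D /L1 EN.
    rewrite [in leRHS]EN; apply: metropolis_minorization => //.
    - exact: bmfunN.
    - by move=> y; rewrite normrN.
    - transitivity (\int[mu]_x (-1 * f x)).
        by apply: eq_Rintegral => y _; rewrite mulN1r.
      rewrite RintegralZl//; last exact: bmfun_integrable.
      by rewrite f0 mulr0.
  by rewrite ler_norml; apply/andP; split; lra.
rewrite RintegralB//; last 2 first.
- by apply: bmfun_integrable; exact: bmfun_metropolis.
- exact: bmfun_integrable.
rewrite Rintegral_metropolis// RintegralZl//; last first.
  by apply: bmfun_integrable; exact: bmfun_indic.
by rewrite Rintegral_indic// /D /L1 mulrAC.
Qed.

(** The minorization holds on sets of measure as close to 1 as desired, with a
    constant that may degenerate as the measure tends to 1. *)
Hypothesis small_sets : forall eta : R, 0 < eta ->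
  exists C eps, [/\ measurable C, (mu (~` C) <= eta%:E)%E, 0 < eps &
                    forall x y, C x -> C y -> eps <= s x y].

(** The sup norm does not increase along the iteration, so one bound [M1] serves
    all the iterates, and a single set [C] with [2 * M1 * mu (~` C) <= e / 2] gives
    a contraction of [L1] towards [e / 2] at every step. *)
Lemma L1_iter_metropolis_cvg0 f : bounded_mfun f -> \int[mu]_x f x = 0 ->
  forall e, 0 < e -> \forall k \near \oo, L1 (iter k T f) <= e.
Proof.
move=> bf f0 e e0; have [_ [M fM]] := bf.
(* [M] may be 0, and [eta] divides by the bound. *)
pose M1 := `|M| + 1.
have M10 : 0 < M1 by rewrite ltr_wpDl.
have fM1 x : `|f x| <= M1.
  by rewrite (le_trans (fM x))// (le_trans (ler_norm _))// /M1 lerDl.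
pose eta := Num.min (1 / 2) (e / 2 / (2 * M1)).
have eta0 : 0 < eta by rewrite lt_min; apply/andP; split; rewrite ?divr_gt0 ?mulr_gt0.
have [C [eps' [mC muC eps'0 sC']]] := small_sets eta0.
(* Capping at 1 keeps the contraction factor [1 - eps * mu C] nonnegative. *)
pose eps := Num.min eps' 1.
have eps0 : 0 < eps by rewrite lt_min eps'0 ltr01.
have eps1 : eps <= 1 by rewrite ge_min lexx orbT.
have sC x y : C x -> C y -> eps <= s x y.
  by move=> Cx Cy; rewrite (le_trans _ (sC' _ _ Cx Cy))// ge_min lexx.
set c' := fine (mu (~` C)); set c := fine (mu C).
have muCc : c = 1 - c'.
  rewrite /c /c' probability_setC// fineB//; last exact: fin_num_measure.
  by rewrite subKr.
have c'ge0 : 0 <= c' by exact: fine_ge0.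
have c'eta : c' <= eta.
  rewrite -lee_fin fineK//; apply: fin_num_measure; exact: measurableC.
have c'12 : c' <= 1 / 2 by rewrite (le_trans c'eta)// ge_min lexx.
have c'e : 2 * M1 * c' <= e / 2.
  rewrite mulrC -ler_pdivlMr ?mulr_gt0// (le_trans c'eta)//.
  by rewrite ge_min lexx orbT.
have k01 : 0 < eps * c <= 1 by rewrite muCc; apply/andP; split; nra.
have step k : L1 (iter k.+1 T f) <= (1 - eps * c) * L1 (iter k T f) + eps * c * (e / 2).
  have := @L1_metropolis_le (iter k T f) M1 C eps (bmfun_iter k bf)
    (iter_metropolis_bound k bf fM1) _ mC (ltW eps0) sC.
  rewrite Rintegral_iter// => /(_ f0) /le_trans; apply.
  rewrite -/c -/c'.
  have [? ?] := andP k01.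
  have : eps * c * (2 * M1 * c') <= eps * c * (e / 2) by rewrite ler_wpM2l// ltW.
  lra.
have e20 : 0 < e / 2 by rewrite divr_gt0.
have := geometric_near (L1 f) k01 e20.
apply: filterS => k; rewrite mulrCA divff// mulr1; apply: le_trans.
elim: k => [|k IHk]; first by rewrite expr0 mul1r lerDr ltW.
rewrite (le_trans (step k))// exprS.
have [? ?] := andP k01.
have : (1 - eps * c) * L1 (iter k T f) <=
  (1 - eps * c) * (e / 2 + (1 - eps * c) ^+ k * L1 f).
  by rewrite ler_wpM2l// subr_ge0.
lra.
Qed.

(** One step from the point [x].  The rejected part multiplies the error at [x] by
    [1 - mass x].  The accepted part is the integral of [iter k T \1_A] against the
    centred density [s x - mass x]; by self-adjointness it is the integral over
    [A] of the iterates of that density, a quantity that [L1] bounds uniformly in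
    [A]. *)
Let metropolis_indicB x k A : bounded_mfun (s x) -> measurable A ->
  `|iter k.+1 T \1_A x - fine (mu A)| <=
    L1 (iter k T (fun y => s x y - mass x)) +
    (1 - mass x) * `|iter k T \1_A x - fine (mu A)|.
Proof.
move=> bs mA; set h := iter k T \1_A.
have bA := bmfun_indic R mA.
have bh : bounded_mfun h by exact: bmfun_iter.
have b0 : bounded_mfun (fun y => s x y - mass x) by apply: bmfunB => //; exact: bmfun_cst.
have hA : \int[mu]_y h y = fine (mu A).
  by rewrite /h Rintegral_iter// Rintegral_indic.
have -> : iter k.+1 T \1_A x - fine (mu A) =
    \int[mu]_y ((s x y - mass x) * h y) + (1 - mass x) * (h x - fine (mu A)).
  have -> : \int[mu]_y ((s x y - mass x) * h y) =
      accept h x - mass x * fine (mu A).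
    rewrite -hA -RintegralZl//; last exact: bmfun_integrable.
    rewrite -RintegralB//; last 2 first.
    - exact: accept_integrable.
    - apply: bmfun_integrable; apply: (@bmfunM _ _ _ (cst (mass x))) => //.
      exact: bmfun_cst.
    by apply: eq_Rintegral => y _; rewrite mulrBl.
  by rewrite [LHS]/= -/h {1}/metropolis; ring.
rewrite (le_trans (ler_normD _ _))//.
have /andP[m0 m1] := mass_bounds x.
rewrite [X in _ + X <= _]normrM (ger0_norm (_ : 0 <= 1 - mass x)) ?subr_ge0//.
rewrite lerD2r /h iter_metropolis_adjoint//.
set g := iter k T _.
have bg : bounded_mfun g by exact: bmfun_iter.
rewrite (le_trans (le_normr_Rintegral _ _))//.
  by apply: bmfun_integrable; exact: bmfunM.
apply: le_Rintegral => //.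
- by apply: bmfun_integrable; apply: bmfun_norm; exact: bmfunM.
- by apply: bmfun_integrable; exact: bmfun_norm.
move=> y _; rewrite normrM indicE.
by case: (y \in A); rewrite ?normr1 ?normr0 ?mul1r ?mul0r.
Qed.

(** Convergence holds from every starting point, not only from almost every one:
    the mass that never moved decays geometrically because [mass x > 0], and the
    rest has a bounded density with respect to [mu]. *)
Theorem metropolis_cvg x : bounded_mfun (s x) -> 0 < mass x ->
  forall e, 0 < e -> \forall k \near \oo,
    forall A, measurable A -> `|iter k T \1_A x - fine (mu A)| <= e.
Proof.
move=> bs m0 e e0; have /andP[_ m1] := mass_bounds x.
have mass01 : 0 < mass x <= 1 by rewrite m0.
have b0 : bounded_mfun (fun y => s x y - mass x) by apply: bmfunB => //; exact: bmfun_cst.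
have i0 : \int[mu]_y (s x y - mass x) = 0.
  rewrite RintegralB//; last by apply: bmfun_integrable; exact: bmfun_cst.
  by rewrite Rintegral_cst// muT mulr1 subrr.
have e20 : 0 < e / 2 by rewrite divr_gt0.
have [K _ HK] := L1_iter_metropolis_cvg0 b0 i0 (mulr_gt0 m0 e20).
have [J _ HJ] := geometric_near 2 mass01 e20.
exists (K + J)%N => // k /= KJk A mA.
have bound j : `|iter (K + j) T \1_A x - fine (mu A)| <=
    e / 2 + (1 - mass x) ^+ j * 2.
  elim: j => [|j IHj].
    rewrite expr0 mul1r (le_trans (ler_normB _ _))//.
    have : `|iter (K + 0) T \1_A x| <= 1.
      apply: iter_metropolis_bound; first exact: bmfun_indic.
      by move=> y; rewrite indicE; case: (y \in A); rewrite ?normr1 ?normr0.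
    have : `|fine (mu A)| <= 1.
      rewrite ger0_norm ?fine_ge0// -lee_fin fineK ?probability_le1//.
      exact: fin_num_measure.
    lra.
  rewrite addnS (le_trans (metropolis_indicB _ _ _))// exprS.
  have := HK (K + j)%N (leq_addr _ _).
  have : (1 - mass x) * `|iter (K + j) T \1_A x - fine (mu A)| <=
     (1 - mass x) * (e / 2 + (1 - mass x) ^+ j * 2).
    by rewrite ler_wpM2l// subr_ge0.
  rewrite /=; lra.
have Kk : (K <= k)%N by rewrite (leq_trans _ KJk)// leq_addr.
rewrite -(subnKC Kk) (le_trans (bound _))// (le_trans (HJ _ _))//=.
  by rewrite leq_subRL.
lra.
Qed.

End metropolis.

(** * Measures given by a density *)

Section density.
Local Open Scope ereal_scope.
Context d (X : measurableType d) (R : realType).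
Variables (m : {measure set X -> \bar R}) (p : X -> R).

(** The proofs are arguments so that the measure structure can be inferred from
    the term. *)
Definition mdensity of measurable_fun setT p & (forall x, (0 <= p x)%R) :=
  fun A : set X => \int[m]_(x in A) (p x)%:E.

Hypotheses (mp : measurable_fun setT p) (p0 : forall x, (0 <= p x)%R).

Let mdensity0 : mdensity mp p0 set0 = 0.
Proof. exact: integral_set0. Qed.

Let mdensity_ge0 A : 0 <= mdensity mp p0 A.
Proof. by apply: integral_ge0 => x _; rewrite lee_fin. Qed.

Let mdensity_sigma_additive : semi_sigma_additive (mdensity mp p0).
Proof.
apply: semi_sigma_additive_nng_induced; first exact/measurable_EFinP.
by move=> x; rewrite lee_fin.
Qed.

HB.instance Definition _ := isMeasure.Build _ _ _ (mdensity mp p0)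
  mdensity0 mdensity_ge0 mdensity_sigma_additive.

Import HBNNSimple.

Let integral_mdensity_nnsfun (f : {nnsfun X >-> R}) :
  \int[mdensity mp p0]_x (f x)%:E = \int[m]_x (f x * p x)%:E.
Proof.
transitivity (\int[m]_x
    (\sum_(r \in range f) (r * \1_(f @^-1` [set r]) x * p x)%:E)); last first.
  apply: eq_integral => x _; rewrite [in RHS]fimfunE fsumEFin//; congr EFin.
  by rewrite -mulr_fsuml.
rewrite ge0_integral_fsum//; last 2 first.
  - by move=> r; apply/measurable_EFinP; do 2 apply: measurable_funM => //.
  - move=> r x _; rewrite EFinM mule_ge0 ?lee_fin//.
    exact: nnfun_muleindic_ge0.
rewrite integralT_nnsfun sintegralE; apply: eq_fsbigr => r rf.
have r0 : (0 <= r)%R by move: rf; rewrite inE => -[x _ <-].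
under [RHS]eq_integral do rewrite -mulrA EFinM.
rewrite ge0_integralZl//; last 2 first.
  - by apply/measurable_EFinP; apply: measurable_funM.
  - by move=> x _; rewrite lee_fin mulr_ge0.
congr (_ * _); rewrite /mdensity [LHS]integral_mkcond; apply: eq_integral => x _.
by rewrite patchE indicE; case: ifPn; rewrite ?mul1r ?mul0r.
Qed.

Lemma integral_mdensity (f : X -> \bar R) :
  measurable_fun setT f -> (forall x, 0 <= f x) ->
  \int[mdensity mp p0]_x f x = \int[m]_x (f x * (p x)%:E).
Proof.
move=> mf f0; pose h := nnsfun_approx measurableT mf.
have hf x : (h n x)%:E @[n --> \oo] --> f x by exact: cvg_nnsfun_approx.
transitivity (limn (fun n => \int[mdensity mp p0]_x (h n x)%:E)).
  rewrite -monotone_convergence//=.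
  - by apply: eq_integral => x _; apply/esym/cvg_lim => //; exact: hf.
  - by move=> n; exact/measurable_EFinP.
  - by move=> n x _; rewrite lee_fin.
  - by move=> x _ a b ab; rewrite lee_fin; exact/lefP/nd_nnsfun_approx.
under eq_fun do rewrite integral_mdensity_nnsfun.
rewrite -monotone_convergence//=.
- apply: eq_integral => x _; apply/cvg_lim => //.
  under eq_fun do rewrite EFinM.
  by apply: cvgeZr => //; exact: hf.
- by move=> n; apply/measurable_EFinP; exact: measurable_funM.
- by move=> n x _; rewrite lee_fin mulr_ge0.
- move=> x _ a b ab; rewrite lee_fin ler_wpM2r//.
  exact/lefP/nd_nnsfun_approx.
Qed.

Hypothesis p1 : \int[m]_x (p x)%:E = 1.

Definition pdensity : probability X R :=
  HB.pack_for (probability X R) (mdensity mp p0)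
    (Measure_isProbability.Build _ _ _ (mdensity mp p0) p1).

Lemma integral_pdensity (f : X -> \bar R) :
  measurable_fun setT f -> (forall x, 0 <= f x) ->
  \int[pdensity]_x f x = \int[m]_x (f x * (p x)%:E).
Proof. exact: integral_mdensity. Qed.

End density.

(** * Integration over the space of row vectors *)

Section lebesgue_rV_product.
Variable R : realType.
Local Open Scope ereal_scope.

Lemma ge0_integral_rVS n (f : 'rV[R]_n.+1 -> \bar R) :
  measurable_fun setT f -> (forall x, 0 <= f x) ->
  \int[lebesgue_rV R n.+1]_x f x =
  \int[lebesgue_measure]_t \int[lebesgue_rV R n]_x f (cons_rV (t, x)).
Proof.
move=> mf f0.
transitivity (\int[pushforward (lebesgue_measure \x lebesgue_rV R n)
    (@cons_rV R n)]_x f x); first by [].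
rewrite ge0_integral_pushforward//; last exact: measurable_cons_rV.
rewrite preimage_setT fubini_tonelli1//; last by move=> x; exact: f0.
by apply: measurableT_comp => //; exact: measurable_cons_rV.
Qed.

Lemma measurable_prod_rV n (F : 'I_n -> R -> R) :
  (forall i, measurable_fun setT (F i)) ->
  measurable_fun setT (fun x : 'rV[R]_n => (\prod_(i < n) F i (x 0%R i))%R).
Proof.
move=> mF; apply: measurable_prod => i _.
by apply: measurableT_comp => //; exact: measurable_coord.
Qed.

Lemma integral_prod_rV n (F : 'I_n -> R -> R) :
  (forall i, measurable_fun setT (F i)) -> (forall i t, (0 <= F i t)%R) ->
  \int[lebesgue_rV R n]_x (\prod_(i < n) F i (x 0%R i))%:E =
  \prod_(i < n) \int[lebesgue_measure]_t (F i t)%:E.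
Proof.
elim: n F => [|n IHn] F mF F0.
  rewrite big_ord0 /= integral_dirac//; last first.
    by apply/measurable_EFinP; exact: measurable_prod_rV.
  by rewrite big_ord0 diracT mule1.
rewrite ge0_integral_rVS; last 2 first.
- by apply/measurable_EFinP; exact: measurable_prod_rV.
- by move=> x; rewrite lee_fin prodr_ge0.
rewrite big_ord_recl -IHn//.
rewrite -ge0_integralZr//; last 3 first.
- apply/measurable_EFinP; exact: mF.
- by move=> t _; rewrite lee_fin.
- by apply: integral_ge0 => x _; rewrite lee_fin prodr_ge0.
apply: eq_integral => t _.
rewrite -ge0_integralZl//; last 3 first.
- apply/measurable_EFinP.
  apply: (@measurable_prod_rV _ (fun i => F (lift ord0 i))) => i.
  exact: mF.
- by move=> x _; rewrite lee_fin prodr_ge0.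
- by rewrite lee_fin.
apply: eq_integral => x _; rewrite -EFinM big_ord_recl cons_rV0 /=.
by congr (_ * _)%:E; apply: eq_bigr => i _; rewrite cons_rVS.
Qed.

End lebesgue_rV_product.

Lemma continuous_measurable_rV (R : realType) n (f : 'rV[R]_n -> R) :
  continuous f -> measurable_fun setT f.
Proof.
move=> cf; apply: (measurability _ (RGenOpens.measurableE R)) => _ [_ [a [b ->]] <-].
rewrite setTI; apply: open_measurable_mx.
by apply: open_comp; [move=> x _; exact: cf|exact: interval_open].
Qed.

(** * Positivity and integrability *)

Lemma integral_gt0 d (X : measurableType d) (R : realType)
    (m : {measure set X -> \bar R}) (f : X -> R) :
  m setT != 0%E -> measurable_fun setT f -> (forall x, 0 < f x) ->
  (0 < \int[m]_x (f x)%:E)%E.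
Proof.
move=> m0 mf f0; rewrite lt_neqAle integral_ge0 ?andbT; last first.
  by move=> x _; rewrite lee_fin ltW.
apply: contra m0 => /eqP/esym I0; apply/eqP.
have mEf : measurable_fun setT (EFin \o f) by exact/measurable_EFinP.
have : ae_eq m setT (EFin \o f) (cst 0%E).
  apply/ae_eq_integral_abs => //; rewrite -[RHS]I0.
  by apply: eq_integral => x _; rewrite /= gtr0_norm.
move=> [N [mN N0 fN]]; apply: (subset_measure0 measurableT mN _ N0).
move=> x _; apply: fN => /= /(_ I) [] fx; have := f0 x.
by rewrite fx ltxx.
Qed.

Lemma integral_expNnorm_lty (R : realType) (c : R) : 0 < c ->
  (\int[lebesgue_measure]_t (expR (- (c * `|t|)))%:E < +oo)%E.
Proof.
move=> c0; rewrite ge0_symfun_integralT//=; last 2 first.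
- move=> x; apply: (@continuous_comp _ _ _ (fun t : R => - (c * `|t|)) expR);
    last exact: continuous_expR.
  apply: (@continuousN _ R^o).
  apply: (@continuousM _ R^o (fun=> c) (fun t => `|t|)).
    exact: cst_continuous.
  exact: norm_continuous.
- by move=> x /=; rewrite normrN.
rewrite lte_mul_pinfty//.
apply: (@le_lt_trans _ _
    (\int[lebesgue_measure]_t (c^-1%:E * (exponential_pdf c t)%:E))%E).
  rewrite integral_mkcond; apply: ge0_le_integral => //=.
  - by move=> x _; rewrite patchE; case: ifPn => // _; rewrite lee_fin expR_ge0.
  - apply/measurable_restrict => //; last first.
      apply/measurable_EFinP; apply: measurable_funTS.
      apply: measurableT_comp => //; apply: measurableT_comp => //.
      apply: measurable_funM => //.
    by rewrite -set_itvcy.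
  - apply/measurable_EFinP; apply: measurable_funM => //.
    exact: measurable_exponential_pdf.
  - move=> x _; rewrite patchE; case: ifPn => [/[!inE]/= x0|_]; last first.
      by rewrite -EFinM lee_fin mulr_ge0 ?invr_ge0 ?exponential_pdf_ge0// ltW.
    rewrite -EFinM lee_fin exponential_pdfE// mulKf ?gt_eqF//.
    by rewrite ger0_norm// mulNr.
rewrite ge0_integralZl//.
- by rewrite integral_exponential_pdf// mule1 ltry.
- by apply/measurable_EFinP; exact: measurable_exponential_pdf.
- by move=> x _; rewrite lee_fin exponential_pdf_ge0// ltW.
- by rewrite lee_fin invr_ge0 ltW.
Qed.

(** * The Euclidean norm *)

Section enorm.
Variables (R : realType) (n : nat).
Implicit Types v : 'rV[R]_n.

Lemma enorm_sqr v : enorm v ^+ 2 = \sum_(i < n) v 0 i ^+ 2.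
Proof.
rewrite /enorm sqr_sqrtr; last by apply: sumr_ge0 => i _; rewrite -expr2 sqr_ge0.
by apply: eq_bigr => i _; rewrite expr2.
Qed.

Lemma coord_le_enorm v i : `|v 0 i| <= enorm v.
Proof.
rewrite -ler_sqr ?nnegrE ?sqrtr_ge0// enorm_sqr real_normK ?num_real//.
by rewrite (bigD1 i)//= lerDl sumr_ge0// => j _; rewrite sqr_ge0.
Qed.

End enorm.

(** * The Metropolis-adjusted Langevin algorithm *)

(** Accepting a move with the Metropolis probability makes the density of the
    accepted moves relative to the target symmetric: here [a] and [b] are the
    proposal densities in the two directions, [p] and [r] the target densities at
    the starting point and at the end point. *)
Lemma metropolis_ratio (R : realType) (a b p r : R) :
  0 < a -> 0 < p -> 0 < r ->
  a * Num.min 1 (b * r / (a * p)) = Num.min (a / r) (b / p) * r.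
Proof.
move=> a0 p0 r0; rewrite minr_pMr ?(ltW a0)// minr_pMl ?(ltW r0)// mulr1.
rewrite divfK ?gt_eqF//; congr Num.min.
by field; rewrite !gt_eqF.
Qed.

Section mala_convergence.
Variables (R : realType) (n : nat) (beta : R) (U : 'rV[R]_n -> R) (h : R).
Hypotheses (n_gt0 : (0 < n)%N) (beta_gt0 : 0 < beta) (h_gt0 : 0 < h).
Hypothesis cU : continuous U.
Hypothesis cG : forall i, continuous (partial i U).
Variable K : R.
Hypothesis K_gt0 : 0 < K.
Hypothesis U_growth : forall x, K * enorm x <= U x.

Local Notation lam := (lebesgue_rV R n).
Local Notation q := (proposal beta U h).
Local Notation dens := (gibbs_density beta U).
Local Notation Z := (partition_fun beta U).
Local Notation acc := (accepted beta U h).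

Let V := 2 * beta^-1 * h.
Let sigma := Num.sqrt V.

Let V_gt0 : 0 < V. Proof. by rewrite /V !mulr_gt0 ?invr_gt0. Qed.
Let sigma2 : sigma ^+ 2 = V. Proof. by rewrite sqr_sqrtr// ltW. Qed.
Let sigma_neq0 : sigma != 0. Proof. by rewrite gt_eqF// sqrtr_gt0. Qed.

Let peak := (4 * pi * beta^-1 * h) `^ (- (n%:R / 2)).

Let peak_gt0 : 0 < peak.
Proof. by apply: powR_gt0; rewrite !mulr_gt0 ?invr_gt0 ?pi_gt0. Qed.

Let normal_peakX : normal_peak sigma ^+ n = peak.
Proof.
rewrite /peak /normal_peak sigma2.
have -> : V * pi *+ 2 = 4 * pi * beta^-1 * h by rewrite /V -mulr_natr; ring.
set a := 4 * _ * _ * _.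
have a0 : 0 < a by rewrite !mulr_gt0 ?invr_gt0 ?pi_gt0.
rewrite powRN mulrC powRrM powR12_sqrt ?ltW// powR_mulrn ?sqrtr_ge0//.
by rewrite exprVn.
Qed.

(** The Langevin proposal is a product of one-dimensional normal densities with
    variance [V = 2 h / beta] centred at the drifted point; this reduces its
    normalization to the one-dimensional Gaussian integral. *)
Let q_prod x y :
  q x y = \prod_(i < n)
    normal_pdf (x 0 i - h * partial i U x) sigma (y 0 i).
Proof.
rewrite /proposal -/peak enorm_sqr.
transitivity (\prod_(i < n) (normal_peak sigma *
    expR (- ((y - x + h *: gradient U x) 0 i ^+ 2 / (4 * beta^-1 * h))))).
  rewrite big_split/= prodr_const card_ord normal_peakX -expR_sum.
  by rewrite sumrN mulr_suml.
apply: eq_bigr => i _; rewrite normal_pdfE//= /normal_fun sigma2 !mxE.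
congr (_ * expR _); rewrite mulNr; congr (- (_ / _)); first by congr (_ ^+ 2); ring.
by rewrite /V -mulr_natr; ring.
Qed.

Let integral_q x : (\int[lam]_y (q x y)%:E = 1)%E.
Proof.
under eq_integral do rewrite q_prod.
rewrite (integral_prod_rV
    (F := fun i => normal_pdf (x 0 i - h * partial i U x) sigma)).
- by rewrite big1// => i _; rewrite integral_normal_pdf.
- by move=> i; exact: measurable_normal_pdf.
- by move=> i t; exact: normal_pdf_ge0.
Qed.

Let q_gt0 x y : 0 < q x y.
Proof. by rewrite mulr_gt0 ?expR_gt0. Qed.

Let q_ge0 x y : 0 <= q x y. Proof. exact/ltW/q_gt0. Qed.

Let q_le x y : q x y <= peak.
Proof.
rewrite ler_piMr ?(ltW peak_gt0)//.
rewrite -expR0 ler_expR oppr_le0 mulr_ge0 ?sqr_ge0// invr_ge0.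
by rewrite !mulr_ge0 ?invr_ge0 ?ltW.
Qed.

Let mU : measurable_fun setT U. Proof. exact: continuous_measurable_rV. Qed.

Let mG i : measurable_fun setT (partial i U).
Proof. exact: continuous_measurable_rV. Qed.

Let mq : measurable_fun setT (fun z : 'rV[R]_n * 'rV[R]_n => q z.1 z.2).
Proof.
apply: measurable_funM => //; apply: measurableT_comp => //.
apply: measurableT_comp => //; apply: measurable_funM => //.
rewrite (_ : (fun z => _) = fun z : 'rV[R]_n * 'rV[R]_n => \sum_(i < n)
    (z.2 0 i - z.1 0 i + h * partial i U z.1) ^+ 2); last first.
  by apply/funext => z; rewrite enorm_sqr; apply: eq_bigr => i _; rewrite !mxE.
apply: measurable_sum => i; apply: measurable_funX.
have mcoord := @measurable_coord R 1 n 0 i.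
apply: measurable_funD.
  apply: measurable_funB.
    exact: (measurableT_comp mcoord measurable_snd).
  exact: (measurableT_comp mcoord measurable_fst).
by apply: measurable_funM => //; exact: (measurableT_comp (mG i) measurable_fst).
Qed.

(** Lebesgue measure charges the whole space, for otherwise the proposal density
    could not integrate to 1. *)
Let lamT_neq0 : lam setT != 0%E.
Proof.
apply/eqP => l0; have /eqP := integral_q 0.
rewrite null_set_integral//; first by rewrite eq_sym onee_eq0.
apply/measurable_EFinP.
exact: (measurableT_comp mq (pair1_measurable (0 : 'rV[R]_n))).
Qed.

Let measurable_expU : measurable_fun setT (fun x => expR (- (beta * U x))).
Proof.
apply: measurableT_comp => //; apply: measurableT_comp => //.
exact: measurable_funM.
Qed.

(** Linear growth of [U] bounds [exp (- beta U)] by a product of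
    one-dimensional exponentials, because every coordinate is at most the
    Euclidean norm. *)
Let integral_expU_lty : (\int[lam]_x (expR (- (beta * U x)))%:E < +oo)%E.
Proof.
pose c := beta * K / n%:R.
have n0 : 0 < n%:R :> R by rewrite ltr0n.
have c0 : 0 < c by rewrite !mulr_gt0 ?invr_gt0.
have mF : measurable_fun setT (fun t : R => expR (- (c * `|t|))).
  apply: measurableT_comp => //; apply: measurableT_comp => //.
  by apply: measurable_funM.
apply: (@le_lt_trans _ _
    (\int[lam]_x (\prod_(i < n) expR (- (c * `|x 0 i|)))%:E)%E).
  apply: ge0_le_integral => //=.
  - exact/measurable_EFinP.
  - apply/measurable_EFinP.
    exact: (measurable_prod_rV (F := fun _ t => expR (- (c * `|t|)))).
  - move=> x _; rewrite lee_fin -expR_sum ler_expR sumrN lerN2 -mulr_sumr.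
    rewrite (@le_trans _ _ (c * (n%:R * enorm x)))//.
      rewrite ler_wpM2l ?(ltW c0)// mulr_natl.
      rewrite -[X in _ *+ X]card_ord -sumr_const.
      by apply: ler_sum => i _; exact: coord_le_enorm.
    rewrite mulrA divfK ?gt_eqF// -mulrA ler_wpM2l ?(ltW beta_gt0)//.
rewrite (integral_prod_rV (F := fun _ t => expR (- (c * `|t|))))//.
have Ic := integral_expNnorm_lty c0.
have I0 : (0 <= \int[lebesgue_measure]_t (expR (- (c * `|t|)))%:E)%E.
  by apply: integral_ge0 => t _; rewrite lee_fin expR_ge0.
set I := (\int[_]_t _)%E in Ic I0 *.
have If : I \is a fin_num by rewrite ge0_fin_numE.
by rewrite -(fineK If) prodEFin ltry.
Qed.

Let EFin_Z : (Z%:E = \int[lam]_x (expR (- (beta * U x)))%:E)%E.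
Proof.
rewrite fineK// ge0_fin_numE//.
by apply: integral_ge0 => t _; rewrite lee_fin expR_ge0.
Qed.

Let Z_gt0 : 0 < Z.
Proof.
by rewrite -lte_fin EFin_Z; apply: integral_gt0 => // x; exact: expR_gt0.
Qed.

Let dens_gt0 x : 0 < dens x.
Proof. by rewrite mulr_gt0 ?invr_gt0 ?expR_gt0. Qed.

Let dens_ge0 x : 0 <= dens x. Proof. exact/ltW. Qed.

Let mdens : measurable_fun setT dens.
Proof. exact: measurable_funM. Qed.

Let integral_dens : (\int[lam]_x (dens x)%:E = 1)%E.
Proof.
under eq_integral do rewrite EFinM.
rewrite ge0_integralZl//; last 2 first.
- exact/measurable_EFinP.
- by rewrite lee_fin invr_ge0 ltW.
by rewrite -EFin_Z -EFinM mulVf// gt_eqF.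
Qed.

Let mu := pdensity mdens dens_ge0 integral_dens.

Let s x y := Num.min (q x y / dens y) (q y x / dens x).

Let acc_s x y : acc x y = s x y * dens y.
Proof. exact: metropolis_ratio. Qed.

Let s_gt0 x y : 0 < s x y.
Proof. by rewrite lt_min !divr_gt0. Qed.

Let s_ge0 x y : 0 <= s x y. Proof. exact/ltW. Qed.

Let s_sym x y : s x y = s y x. Proof. by rewrite /s minC. Qed.

Let ms : measurable_fun setT (fun z : 'rV[R]_n * 'rV[R]_n => s z.1 z.2).
Proof.
have mdV : measurable_fun setT (fun x => (dens x)^-1).
  rewrite (_ : (fun x => _) = fun x => Z * expR (beta * U x)); last first.
    by apply/funext => x; rewrite /gibbs_density invfM invrK -expRN opprK.
  apply: measurable_funM => //; apply: measurableT_comp => //.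
  exact: measurable_funM.
apply: measurable_minr; apply: measurable_funM.
- exact: mq.
- exact: (measurableT_comp mdV measurable_snd).
- exact: (measurableT_comp mq (@measurable_swap _ _ _ _)).
- exact: (measurableT_comp mdV measurable_fst).
Qed.

Let ms1 x : measurable_fun setT (s x).
Proof. exact: (measurableT_comp ms (pair1_measurable x)). Qed.

Let macc x : measurable_fun setT (acc x).
Proof.
rewrite (_ : acc x = fun y => s x y * dens y).
  exact: measurable_funM.
by apply/funext => y; exact: acc_s.
Qed.

Let acc_ge0 x y : 0 <= acc x y.
Proof. by rewrite acc_s mulr_ge0. Qed.

Let integral_s x : (\int[mu]_y (s x y)%:E = \int[lam]_y (acc x y)%:E)%E.
Proof.
rewrite integral_pdensity; [|exact/measurable_EFinP
  |by move=> y; rewrite lee_fin].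
by apply: eq_integral => y _; rewrite acc_s EFinM.
Qed.

Let s_le1 x : (\int[mu]_y (s x y)%:E <= 1)%E.
Proof.
rewrite integral_s -(integral_q x); apply: ge0_le_integral => //.
- by move=> y _; rewrite lee_fin.
- exact/measurable_EFinP.
- apply/measurable_EFinP.
  exact: (measurableT_comp mq (pair1_measurable x)).
- move=> y _; rewrite lee_fin /accepted ler_piMr//.
  by rewrite ge_min lexx.
Qed.

Let kern := metropolis mu s.

Let mass1 x : (\int[lam]_y (acc x y)%:E = (mass mu s x)%:E)%E.
Proof.
rewrite -integral_s /mass /Rintegral fineK// ge0_fin_numE.
  exact: le_lt_trans (s_le1 x) (ltry _).
by apply: integral_ge0 => y _; rewrite lee_fin.
Qed.

Let mass_gt0 x : 0 < mass mu s x.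
Proof.
rewrite -lte_fin -mass1; apply: integral_gt0 => // y.
by rewrite acc_s mulr_gt0.
Qed.

Let rej_ge0 x : 0 <= 1 - mass mu s x.
Proof. by rewrite subr_ge0; case/andP: (mass_bounds ms s_ge0 s_le1 x). Qed.

Let kern_ge0 k A x : measurable A -> 0 <= iter k kern \1_A x.
Proof.
move=> mA; elim: k x => [|k IHk] x /=; first by rewrite indicE.
exact: metropolis_ge0.
Qed.

(** The kernel is a genuine measure, the sum of one with density [acc x] and of a
    nonnegative multiple of a Dirac mass, so that integrals against it can be
    computed. *)
Let mala_iterE k x A : measurable A ->
  mala_iter beta U h k x A = (iter k kern \1_A x)%:E.
Proof.
move=> mA; elim: k x => [//|k IHk] x /=.
have bg : bounded_mfun (iter k kern \1_A).
  by apply: bmfun_iter => //; exact: bmfun_indic.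
have -> : (fun y => mala_iter beta U h k y A) =
    fun y => (iter k kern \1_A y)%:E by apply/funext => y; exact: IHk.
have mg : measurable_fun setT (fun y => (iter k kern \1_A y)%:E).
  by apply/measurable_EFinP; case: bg.
have g0 y : (0 <= (iter k kern \1_A y)%:E)%E by rewrite lee_fin kern_ge0.
pose r := NngNum (rej_ge0 x).
have -> : mala_kernel beta U h x =
    measure_add (mdensity lam (macc x) (acc_ge0 x)) (mscale r (dirac x)).
  apply/funext => B; rewrite measure_addE /mala_kernel; congr (_ + _)%E.
  by rewrite /mscale /rejection mass1 EFinB.
rewrite ge0_integral_measure_add// ge0_integral_mscale// integral_dirac//.
set g := iter k kern \1_A in bg mg g0 *.
rewrite diracT mul1e integral_mdensity//.
rewrite -[RHS]/((accept mu s g x + (1 - mass mu s x) * g x)%:E).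
rewrite [RHS]EFinD [X in _ = (_ + X)%E]EFinM; congr (_ + _)%E.
rewrite EFin_accept// integral_pdensity.
- by apply: eq_integral => y _; rewrite acc_s !EFinM muleA (muleC (s x y)%:E).
- by apply/measurable_EFinP; apply: measurable_funM => //; case: bg.
- by move=> y; rewrite lee_fin mulr_ge0// kern_ge0.
Qed.

(** Sublevel sets of [extent] exhaust the space, and on each of them the
    displacement [y - x + h * grad U x] is bounded, and so is the exponent of the
    Gaussian proposal. *)
Let extent (x : 'rV[R]_n) : R := \sum_(i < n) (`|x 0 i| + h * `|partial i U x|).

Let measurable_extent : measurable_fun setT extent.
Proof.
apply: measurable_sum => i; apply: measurable_funD.
  by apply: measurableT_comp => //; exact: measurable_coord.
by apply: measurable_funM => //; exact: measurableT_comp.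
Qed.

Let measurable_extent_le (N : R) : measurable [set x | extent x <= N].
Proof.
rewrite (_ : [set x | _] = extent @^-1` `]-oo, N]%classic); last first.
  by apply/seteqP; split => x /=; rewrite in_itv.
by rewrite -[X in measurable X]setTI; exact: measurable_extent.
Qed.

(** [c] is the smallest value that the proposal can take when no coordinate of the
    displacement exceeds [2 N] in absolute value; and the target density is at most [Z^-1], as
    [U >= 0]. *)
Let s_lb (N : R) : exists2 eps, 0 < eps &
  forall x y, extent x <= N -> extent y <= N -> eps <= s x y.
Proof.
pose c := peak * expR (- (n%:R * (N + N) ^+ 2 / (4 * beta^-1 * h))).
have c0 : 0 < c by rewrite mulr_gt0 ?expR_gt0.
have qc x y : extent x <= N -> extent y <= N -> c <= q x y.
  move=> xN yN; rewrite ler_wpM2l ?(ltW peak_gt0)// ler_expR lerN2.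
  rewrite ler_wpM2r ?invr_ge0 ?mulr_ge0 ?invr_ge0 ?(ltW beta_gt0) ?(ltW h_gt0)//.
  rewrite enorm_sqr mulr_natl -[X in _ *+ X]card_ord -sumr_const.
  apply: ler_sum => i _; rewrite !mxE -[leLHS]real_normK ?num_real//.
  have coord_le (z : 'rV[R]_n) : `|z 0 i| + h * `|partial i U z| <= extent z.
    rewrite /extent (bigD1 i)//= lerDl sumr_ge0// => j _.
    by rewrite addr_ge0// mulr_ge0// ltW.
  have a_le : `|y 0 i - x 0 i + h * partial i U x| <= N + N.
    rewrite (le_trans (ler_normD _ _))// normrM (gtr0_norm h_gt0).
    have := ler_normB (y 0 i) (x 0 i); have := coord_le x; have := coord_le y.
    have : 0 <= h * `|partial i U y| by rewrite mulr_ge0// ltW.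
    lra.
  by rewrite ler_sqr ?nnegrE// (le_trans _ a_le).
have densZ x : dens x <= Z^-1.
  rewrite ler_piMr ?invr_ge0 ?(ltW Z_gt0)// -expR0 ler_expR oppr_le0.
  rewrite mulr_ge0 ?(ltW beta_gt0)// (le_trans _ (U_growth x))//.
  by rewrite mulr_ge0 ?(ltW K_gt0)// sqrtr_ge0.
have ratio x y z : extent x <= N -> extent y <= N -> c * Z <= q x y / dens z.
  move=> xN yN; rewrite ler_pM ?(ltW c0) ?(ltW Z_gt0) ?qc//.
  by rewrite -[leLHS]invrK lef_pV2 ?posrE ?invr_gt0.
exists (c * Z); first exact: mulr_gt0.
by move=> x y xN yN; rewrite le_min !ratio.
Qed.

Let small_sets eta : 0 < eta -> exists C eps,
  [/\ measurable C, (mu (~` C) <= eta%:E)%E, 0 < eps &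
      forall x y, C x -> C y -> eps <= s x y].
Proof.
move=> eta0; pose F (N : nat) := ~` [set x | extent x <= N%:R].
have mF N : measurable (F N) by apply: measurableC; exact: measurable_extent_le.
have F0 : \bigcap_N F N = set0.
  apply/seteqP; split => // x Fx; apply: (Fx (Num.bound `|extent x|) I) => /=.
  by rewrite (le_trans (ler_norm _))// ltW// archi_boundP.
have : (mu \o F) @ \oo --> 0%E.
  rewrite -(measure0 mu) -F0; apply: nonincreasing_cvg_mu => //.
  - by rewrite -ge0_fin_numE//; exact: fin_num_measure.
  - by rewrite F0.
  - move=> a b ab; apply/subsetPset => x; apply: contra_not => /= xa.
    by rewrite (le_trans xa)// ler_nat.
move=> /fine_cvgP[_ /cvgrPdist_le/(_ _ eta0)[N _ /(_ N (leqnn _))]].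
rewrite /= sub0r normrN ger0_norm ?fine_ge0// => muF.
have [eps eps0 epsP] := s_lb N%:R.
exists [set x | extent x <= N%:R], eps; split => //.
rewrite -[leLHS]fineK; first by rewrite lee_fin; exact: muF.
exact: (fin_num_measure mu _ (mF N)).
Qed.

Theorem mala_tv x e : 0 < e -> \forall k \near \oo,
  forall A, measurable A ->
    (`|mala_iter beta U h k x A - gibbs beta U A| <= e%:E)%E.
Proof.
move=> e0.
have bs : bounded_mfun (s x).
  split => //; exists (peak / dens x) => y.
  by rewrite ger0_norm// /s ge_min ler_pM2r ?invr_gt0// q_le orbT.
have := metropolis_cvg ms s_ge0 s_sym s_le1 small_sets bs (mass_gt0 x) e0.
apply: filterS => k Hk A mA.
rewrite mala_iterE//.
have -> : gibbs beta U A = (fine (mu A))%:E.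
  by rewrite fineK//; exact: fin_num_measure.
by rewrite -EFinB /= lee_fin Hk.
Qed.

End mala_convergence.

Theorem theorem4p4 (R : realType) (n : nat) (n_ge1 : (1 <= n)%N) (beta : R)
    (beta_gt0 : 0 < beta) (U : 'rV[R]_n -> R) (U_smooth : smooth U)
    (U_growth : exists2 K1 : R, 0 < K1 & forall x, K1 * enorm x <= U x)
    (U_lyapunov : forall l : nat, (1 <= l)%N ->
      exists delta M : R, [/\ 0 < delta, 0 < M &
        forall x, generator beta U (fun y => U y ^+ l) x <=
                  - delta * U x ^+ l + M])
    (U_lipschitz : exists2 K2 : R, 0 < K2 & forall x y,
      enorm (gradient U x - gradient U y) <= K2 * (U x + U y) * enorm (x - y))
    (U_onesided : exists2 K3 : R, 0 < K3 & forall x y,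
      dotp (- gradient U x + gradient U y) (x - y) <= K3 * enorm (x - y) ^+ 2)
    (U_derivatives : exists2 K4 : R, 0 < K4 & forall x,
      Num.max (Num.max (normD3 U x) (normD2 U x)) (enorm (gradient U x)) <=
      K4 * (1 + U x))
    (h : R) (h_gt0 : 0 < h) :
  forall x : 'rV[R]_n,
    (fun k : nat => ereal_sup [set `|mala_iter beta U h k x A - gibbs beta U A|%E
                              | A in measurable]) @ \oo --> 0%E.
Proof.
move=> x; have [K1 K1_gt0 U_ge] := U_growth.
have cG i : continuous (partial i U) by have [_] := U_smooth 1%N; exact.
have TV := mala_tv n_ge1 beta_gt0 h_gt0 (U_smooth 0%N) cG K1_gt0 U_ge x.
set S := fun k : nat => ereal_sup _.
have S_ge0 k : (0 <= S k)%E.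
  by apply: le_trans (ereal_sup_ubound _); last by exists set0.
have S_le e : 0 < e -> \forall k \near \oo, (S k <= e%:E)%E.
  move=> /TV; apply: filterS => k H.
  by apply: ge_ereal_sup => _ [A mA <-]; exact: H.
have S_fin e k : (S k <= e%:E)%E -> S k \is a fin_num.
  by move=> Se; rewrite ge0_fin_numE// (le_lt_trans Se)// ltry.
apply/fine_cvgP; split; first by apply: filterS (S_le 1 ltr01) => k; exact: S_fin.
apply/cvgrPdist_le => e e0; apply: filterS (S_le e e0) => k Sk.
rewrite sub0r normrN ger0_norm ?fine_ge0//=.
by rewrite -lee_fin fineK//; exact: S_fin Sk.
Qed.
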